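(* Let $\psi\in C^2([0,\infty))$ be a real-valued function satisfying $$\psi'(0)=0\qquad\text{and}\qquad\psi'(x)\geq0\quad\text{for all }x>0,$$ and $$\psi''(x)\sinh x-\psi'(x)\cosh x\geq0\quad\text{for all }x>0,$$ or equivalently $\psi''(x)\geq\psi'(x)\coth x$ for all $x>0$. Then the function $$g(s)=\psi\left(\operatorname{arcosh}\frac{s}{2}\right),\qquad s\geq2,$$ is convex and non-decreasing on $[2,\infty)$. Moreover, the function $\bar g\colon[0,\infty)\to\mathbb{R}$ given by $$\bar g(s)=\begin{cases}\psi(0)+\frac12\psi''(0)(s-2),&0\leq s\leq2,\\[0.5em]\psi\left(\operatorname{arcosh}\frac{s}{2}\right),&s\geq2,\end{cases}$$ is a convex and non-decreasing extension of $g$. Consequently, the energy $W_\psi(F)=\sum_{i=1}^3\psi(|\log\lambda_i|)$, $F\in\mathrm{SL}(3)$, where $\lambda_i=\nu_i(F)$, is the restriction to $\mathrm{SL}(3)$ of a polyconvex function: the function $P(X,Y,d)=\sum_{i=1}^3\bar g(\nu_i(X+Y))$ is convex on $\mathbb{R}^{3\times3}\times\mathbb{R}^{3\times3}\times(0,\infty)$ and $W_\psi(F)=P(F,\operatorname{Cof}F,\det F)$ for all $F\in\mathrm{SL}(3)$. In particular, $W_\psi$ is rank-one convex on $\mathrm{SL}(3)$.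
   Context: For $X\in\mathbb{R}^{3\times3}$, $\nu_1(X),\nu_2(X),\nu_3(X)\ge0$ denote its singular values, counted with multiplicity. For invertible $F$, $\operatorname{Cof}F=(\det F)F^{-T}$. $\mathrm{SL}(3)$ is the set of real $3\times3$ matrices with determinant $1$. $\operatorname{arcosh}\colon[1,\infty)\to[0,\infty)$ is the inverse of $\cosh$ on $[0,\infty)$. $C^2([0,\infty))$ means twice continuously differentiable up to $0$ (one-sided derivatives at $0$). A function $W\colon\mathrm{SL}(3)\to\mathbb{R}$ is rank-one convex on $\mathrm{SL}(3)$ if, for all $F\in\mathrm{SL}(3)$ and $a,b\in\mathbb{R}^3$ such that $F_t=F+t\,a\otimes b\in\mathrm{SL}(3)$ for all $t\in[0,1]$, the function $t\mapsto W(F_t)$ is convex on $[0,1]$. Here $a\otimes b=ab^T$. *)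

(* Defs.v *)
From HB Require Import structures.
From mathcomp Require Import all_boot all_order all_algebra.
From mathcomp Require Import all_classical all_reals all_analysis.
From mathcomp Require complex.

Set Implicit Arguments.
Unset Strict Implicit.
Unset Printing Implicit Defensive.

Import Order.TTheory GRing.Theory Num.Theory.
Import numFieldNormedType.Exports.

Local Open Scope classical_set_scope.
Local Open Scope ring_scope.

Section Calculus.
Variable R : realType.
Implicit Types (A : set R) (f : R -> R) (x : R).

(* Difference quotients are taken along [within A x^'], so that at the boundary
   of an interval [A] the derivative is one-sided, while at its interior points
   it is the usual one. Only the values of [f] on [A] matter for [x] in [A]. *)
Definition derivable1_within A f x : Prop :=
  cvg ((f y - f x) / (y - x) @[y --> within A x^']).

Definition derive1_within A f x : R :=
  lim ((f y - f x) / (y - x) @[y --> within A x^']).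

Definition C2_within A f : Prop :=
  [/\ {in A, forall x, derivable1_within A f x},
      {in A, forall x, derivable1_within A (derive1_within A f) x} &
      {within A, continuous (derive1_within A (derive1_within A f))}].

Definition nonneg_reals : set R := `[0, +oo[%classic.

Definition cosh x : R := (expR x + expR (- x)) / 2.
Definition sinh x : R := (expR x - expR (- x)) / 2.
Definition coth x : R := cosh x / sinh x.

Definition arcosh : R -> R := 'pinv_(fun=> 0) nonneg_reals cosh.

End Calculus.

Section Matrices.
Variables (R : realType) (n : nat).
Implicit Types (X F : 'M[R]_n).

Definition SL : set 'M[R]_n := [set F | \det F = 1].

(* This is (det F) F^{-T} only for invertible F: [invmx] is the identity on
   singular matrices. *)
Definition Cof F : 'M[R]_n := \det F *: (invmx F)^T.

(* [s] lists, with multiplicity, the nonnegative square roots of the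
   eigenvalues of X^T X. *)
Definition is_singular_values X (s : 'rV[R]_n) : Prop :=
  (forall i, 0 <= s 0 i) /\
  char_poly (X^T *m X) = \prod_(i < n) ('X - (s 0 i ^+ 2)%:P).

(* The order of the entries is unspecified; that such a list exists is
   [singular_valuesP] below. *)
Definition singular_values X : 'rV[R]_n := xget 0 [set s | is_singular_values X s].

Definition singular_value X (i : 'I_n) : R := singular_values X 0 i.

(* [W] stands for a function on SL(n): only its values there are used. *)
Definition rank_one_convex_SL (W : 'M[R]_n -> R) : Prop :=
  forall (F : 'M[R]_n) (a b : 'cV[R]_n), SL F ->
    (forall t : R, 0 <= t <= 1 -> SL (F + t *: (a *m b^T))) ->
    convex_function (E := R^o) `[0, 1]%classic
      (fun t : R => W (F + t *: (a *m b^T))).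

End Matrices.

Section SingularValuesExist.
Import complex.
Local Open Scope sesquilinear_scope.

Lemma char_poly_conj (F : fieldType) n (P D : 'M[F]_n) : P \in unitmx ->
  char_poly (invmx P *m D *m P) = char_poly D.
Proof.
move=> Pu; rewrite /char_poly.
have uP : map_mx (@polyC F) (invmx P) *m map_mx (@polyC F) P = 1%:M.
  by rewrite -map_mxM mulVmx // map_mx1.
have -> : char_poly_mx (invmx P *m D *m P) =
    map_mx (@polyC F) (invmx P) *m char_poly_mx D *m map_mx (@polyC F) P.
  by rewrite /char_poly_mx mulmxBr mulmxBl !map_mxM scalar_mxC -[_%:M *m _ *m _]mulmxA uP mulmx1.
by rewrite !det_mulmx mulrC mulrA -det_mulmx (mulmx1C uP) det1 mul1r.
Qed.

Lemma singular_valuesP (R : realType) n (X : 'M[R]_n) :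
  is_singular_values X (singular_values X).
Proof.
rewrite /singular_values; apply: xgetPex => /=.
pose toC := real_complex R; pose Y := map_mx toC X; pose A := map_mx toC (X^T *m X).
have conjR (x : R) : (toC x)^* = toC x by exact: conjc_real.
have YtE : Y^t* = map_mx toC X^T by apply/matrixP => i j; rewrite !mxE conjR.
have AE : A = Y^t* *m Y by rewrite YtE /A map_mxM.
have An : A \is normalmx.
  have -> : A = A^t* by rewrite AE trmx_mul map_mxM trmxCK.
  by apply/normalmxP; rewrite trmxCK -[A^t*]/(A ^t*) AE !(trmx_mul, map_mxM, trmxCK).
have := orthomx_spectralP An; set P := spectralmx A; set d := spectral_diag A => PdP.
have PU : P \is unitarymx := spectral_unitarymx A.
have Pu : P \in unitmx := spectral_unit A.
have dE i : d 0 i = \sum_k `|(Y *m P^t*) k i| ^+ 2.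
  have : diag_mx d = (Y *m P^t*) ^t* *m (Y *m P^t*).
    rewrite trmx_mul map_mxM trmxCK mulmxA -(mulmxA P) -AE PdP.
    by rewrite -(invmx_unitary PU) !mulmxA mulmxV // mul1mx mulmxK.
  move=> /matrixP/(_ i i); rewrite !mxE eqxx mulr1n => ->.
  by apply: eq_bigr => k _; rewrite !mxE normCK mulrC.
have d_ge0 i : 0 <= d 0 i by rewrite dE sumr_ge0 // => k _; rewrite exprn_ge0.
exists (\row_i Num.sqrt (Re (d 0 i))); split=> [i|]; first by rewrite mxE sqrtr_ge0.
apply: (map_poly_inj toC); rewrite map_char_poly -/A PdP char_poly_conj //.
rewrite char_poly_trig; last first.
  by apply/is_trig_mxP => i j ij; rewrite !mxE -val_eqE ltn_eqF.
rewrite rmorph_prod; apply: eq_bigr => i _ /=.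
rewrite rmorphB /= map_polyX map_polyC /= !mxE eqxx mulr1n sqr_sqrtr.
  by rewrite (RRe_real (ger0_real (d_ge0 i))).
by have := d_ge0 i; rewrite lecE => /andP[].
Qed.
End SingularValuesExist.

Section Polyconvexity.
Variable R : realType.

Definition M3xM3xR : lmodType R := ('M[R]_3 * 'M[R]_3 * R^o)%type.

Definition M3xM3xpos : set M3xM3xR := [set Z | 0 < Z.2].

(* [W] stands for a function on the real 3x3 matrices of positive determinant. *)
Definition polyconvex (W : 'M[R]_3 -> R) : Prop :=
  exists P : M3xM3xR -> R, convex_function M3xM3xpos P /\
    forall F : 'M[R]_3, 0 < \det F -> W F = P (F, Cof F, \det F).

End Polyconvexity.

Section Energy.
Variables (R : realType) (psi : R -> R).

Definition dpsi : R -> R := derive1_within (@nonneg_reals R) psi.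
Definition d2psi : R -> R := derive1_within (@nonneg_reals R) dpsi.

Definition g_psi (s : R) : R := psi (arcosh (s / 2)).

Definition gbar_psi (s : R) : R :=
  if s <= 2 then psi 0 + 2^-1 * d2psi 0 * (s - 2) else psi (arcosh (s / 2)).

Definition W_psi (F : 'M[R]_3) : R :=
  \sum_(i < 3) psi `|ln (singular_value F i)|.

Definition P_psi (Z : M3xM3xR R) : R :=
  \sum_(i < 3) gbar_psi (singular_value (Z.1.1 + Z.1.2) i).

End Energy.

(* Main.v *)
(** Put [q x = psi' x / sinh x]. The differential inequality says that [q] is
nondecreasing on (0, oo), and its limit at 0 is [psi'' 0]. By Cauchy's mean value
theorem for [psi] and [cosh], [psi b - psi a = q c * (cosh b - cosh a)], so that,
as a function of [s = 2 cosh x], [psi] has a supporting line of slope [q x / 2 >= 0]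
at every point; extending it to s <= 2 by the line of slope [psi'' 0 / 2] makes
gbar a function on the whole real line with supporting lines of nonnegative slope.

For such a [phi], [X |-> sum_i phi (nu_i X)] is convex. If [Z = U S V^*] is a
singular value decomposition, then [nu_i Z = Re (U^* Z V)_ii] is linear in [Z] for
fixed U and V, so it suffices to bound [sum_i phi (Re (U^* X V)_ii)] by
[sum_i phi (nu_i X)]. Inserting a decomposition of X,
[Re (U^* X V)_ii <= sum_k m_ik nu_k X] with [m_ik] the average of the squared moduli
of entries of two contractions; [m] is doubly substochastic, and Jensen concludes.

If det F = 1, the singular values of [F + Cof F = F + F^-T] are
[l_i + 1 / l_i = 2 cosh (log l_i)]. Along a rank-one line in SL, [Cof] is affine by
the Sherman-Morrison formula, so rank-one convexity follows from the same convexity. *)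

Require Import Defs.
From mathcomp Require Import all_boot all_order all_algebra.
From mathcomp Require Import all_classical all_reals all_analysis.
From mathcomp Require complex.
From mathcomp Require Import ring lra.
Import Order.TTheory GRing.Theory Num.Theory.
Import numFieldNormedType.Exports.
Local Open Scope classical_set_scope.
Local Open Scope ring_scope.

Set Implicit Arguments.
Unset Strict Implicit.
Unset Printing Implicit Defensive.

(** * One-sided derivatives on [0, oo) *)

Section OneSidedDerivatives.
Variable R : realType.
Implicit Types (f : R -> R) (x a b : R).

Lemma derivable1_within_is_derive f x : 0 < x ->
  derivable1_within (@nonneg_reals R) f x ->
  is_derive x 1 f (derive1_within (@nonneg_reals R) f x).
Proof.
move=> x0 fx; set l := derive1_within _ _ _.
have wE : within (@nonneg_reals R) x^' = x^'.
  rewrite eqEsubset; split; last by move=> P; apply: filterS => y Py _.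
  move=> P PA; apply: (@filterS2 _ _ _ _ _ _ _ (lt_nbhsr x0) PA) => y y0 Py yx.
  by apply: Py => //; rewrite /nonneg_reals /= in_itv /= andbT ltW.
apply/is_derive1_caratheodory.
exists (fun y => if y == x then l else (f y - f x) / (y - x)); split.
- move=> z; case: eqVneq => [->|zx]; first by rewrite !subrr mulr0.
  by rewrite divfK // subr_eq0.
- apply/continuous_withinNx; rewrite eqxx.
  have : (f y - f x) / (y - x) @[y --> x^'] --> l by rewrite -wE; exact: fx.
  apply: cvg_trans; apply: near_eq_cvg; near=> y.
  by rewrite ifN //; near: y; exact: nbhs_dnbhs_neq.
- by rewrite eqxx.
Unshelve. all: by end_near. Qed.

Lemma at_right0_within : (0 : R)^'+ `=>` within (@nonneg_reals R) (0 : R)^'.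
Proof.
move=> P PA; apply: (@filterS _ (nbhs (0 : R)) _ _ _ _ PA) => y Py y0; apply: Py.
  by rewrite gt_eqF.
by rewrite /nonneg_reals /= in_itv /= andbT ltW.
Qed.

Lemma derivable1_within_cvg0 f :
  derivable1_within (@nonneg_reals R) f 0 ->
  (f y - f 0) / y @[y --> 0^'+] --> derive1_within (@nonneg_reals R) f 0.
Proof.
have E : (fun y => (f y - f 0) / (y - 0)) = (fun y => (f y - f 0) / y).
  by apply/funext => y; rewrite subr0.
rewrite /derivable1_within /derive1_within E => f0.
exact: cvg_trans (cvg_app _ at_right0_within) f0.
Qed.

(** Supplies the continuity up to the endpoint that Cauchy's mean value theorem requires when a = 0.
    At 0 it comes from f y = f 0 + slope * y, the slope being convergent. *)
Lemma derivable1_within_continuous f a b : 0 <= a -> a < b ->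
  {in @nonneg_reals R, forall x, derivable1_within (@nonneg_reals R) f x} ->
  {within `[a, b], continuous f}.
Proof.
move=> a0 ab fd.
have fdx x : 0 < x -> {for x, continuous f}.
  move=> x0; apply: differentiable_continuous; apply/derivable1_diffP.
  have xA : x \in @nonneg_reals R by rewrite inE /nonneg_reals /= in_itv /= andbT ltW.
  by have [] := derivable1_within_is_derive x0 (fd x xA).
have f0 : f y @[y --> 0^'+] --> f 0.
  have A0 : 0 \in @nonneg_reals R by rewrite inE /nonneg_reals /= in_itv /= lexx.
  have := derivable1_within_cvg0 (fd 0 A0); set l := derive1_within _ _ _ => fl.
  have idc : (y : R) @[y --> 0^'+] --> (0 : R).
    by apply: cvg_at_right_filter; exact: cvg_id.
  have flD : f 0 + (f y - f 0) / y * y @[y --> 0^'+] --> f 0.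
    rewrite -[X in _ --> X]addr0 -[X in _ --> _ + X](mulr0 l).
    by apply: cvgD; [exact: cvg_cst|exact: cvgM].
  apply: cvg_trans flD; apply: near_eq_cvg; near=> y.
  by rewrite /= divfK ?gt_eqF // addrC subrK.
apply/continuous_within_itvP => //; split.
- by move=> x; rewrite in_itv /= => /andP[ax _]; apply: fdx; exact: le_lt_trans ax.
- move: a0; rewrite le_eqVlt => /predU1P[<- //|a0].
  by apply: cvg_at_right_filter; exact: fdx.
- by apply: cvg_at_left_filter; apply: fdx; exact: le_lt_trans ab.
Unshelve. all: by end_near. Qed.

End OneSidedDerivatives.

(** * Hyperbolic functions *)

Section Hyperbolic.
Variable R : realType.
Implicit Types x y s : R.

Lemma is_derive_expRN x : is_derive x 1 (fun y : R => expR (- y)) (- expR (- x)).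
Proof.
by rewrite -mulrN1; exact: is_derive1_comp (is_derive_expR (- x)) (is_deriveNid x 1).
Qed.

Lemma is_derive_cosh x : is_derive x 1 (@cosh R) (sinh x).
Proof.
have -> : @cosh R = 2^-1 \*: (expR \+ (fun y => expR (- y))).
  by apply/funext => y; rewrite /cosh /= mulrC.
have -> : sinh x = 2^-1 *: (expR x + - expR (- x)) by rewrite /sinh mulrC.
exact: is_deriveZ (is_deriveD (is_derive_expR x) (is_derive_expRN x)).
Qed.

Lemma is_derive_sinh x : is_derive x 1 (@sinh R) (cosh x).
Proof.
have -> : @sinh R = 2^-1 \*: (expR \- (fun y => expR (- y))).
  by apply/funext => y; rewrite /sinh /= mulrC.
have -> : cosh x = 2^-1 *: (expR x - - expR (- x)) by rewrite /cosh mulrC opprK.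
exact: is_deriveZ (is_deriveB (is_derive_expR x) (is_derive_expRN x)).
Qed.

Lemma cosh0 : cosh 0 = 1 :> R.
Proof. by rewrite /cosh oppr0 expR0; lra. Qed.

Lemma sinh_gt0 x : 0 < x -> 0 < sinh x.
Proof. by move=> x0; rewrite divr_gt0 // subr_gt0 ltr_expR; lra. Qed.

Lemma continuous_cosh : continuous (@cosh R).
Proof.
move=> x; apply: differentiable_continuous; apply/derivable1_diffP.
by case: (is_derive_cosh x).
Qed.

Lemma cosh_lt x y : 0 <= x -> x < y -> cosh x < cosh y.
Proof.
move=> x0 xy.
have [c] := MVT xy (fun z _ => is_derive_cosh z) (continuous_subspaceT continuous_cosh).
rewrite in_itv /= => /andP[xc _] E; rewrite -subr_gt0 E mulr_gt0 ?subr_gt0 //.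
by apply: sinh_gt0; exact: le_lt_trans xc.
Qed.

Lemma cosh_ge1 x : 0 <= x -> 1 <= cosh x.
Proof.
by rewrite le_eqVlt => /predU1P[<-|x0]; rewrite ?cosh0 // ltW // -cosh0 cosh_lt.
Qed.

Lemma coshK x : 0 <= x -> arcosh (cosh x) = x.
Proof.
move=> x0; apply: pinvKV; last by rewrite inE /nonneg_reals /= in_itv /= andbT.
move=> a b; rewrite !inE /nonneg_reals /= !in_itv /= !andbT => a0 b0 ab.
by case: (ltgtP a b) => // lt;
  [have := cosh_lt a0 lt | have := cosh_lt b0 lt]; rewrite ab ltxx.
Qed.

Lemma cosh_ln s : 0 < s -> cosh `|ln s| = (s + s^-1) / 2.
Proof.
move=> s0; have E : cosh (ln s) = (s + s^-1) / 2 by rewrite /cosh expRN lnK.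
have [_|_] := ger0P (ln s) => //.
by rewrite -E /cosh opprK addrC.
Qed.

Lemma cosh_surj s : 1 <= s -> exists2 x, 0 <= x & cosh x = s.
Proof.
(* The larger root of y + 1 / y = 2 s, that is, exp x for the x sought. Taking [|ln y|] spares the
   proof that y >= 1. *)
move=> s1; pose y := s + Num.sqrt (s ^+ 2 - 1).
have sy : 0 <= s ^+ 2 - 1 by nra.
have y0 : 0 < y by rewrite ltr_pwDl ?sqrtr_ge0 //; lra.
exists `|ln y|; first exact: normr_ge0.
have q : Num.sqrt (s ^+ 2 - 1) ^+ 2 = s ^+ 2 - 1 by rewrite sqr_sqrtr.
rewrite cosh_ln //; have yn : y != 0 by rewrite gt_eqF.
apply: (mulIf yn); rewrite mulrAC mulrDl mulVf // /y; set r := Num.sqrt _ in q *; nra.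
Qed.

(** The mean value theorem gives sinh x = x cosh c with c < x. This compares psi' y / y with [q y]
    near 0. *)
Lemma sinh_le x : 0 < x -> sinh x <= x * cosh x.
Proof.
move=> x0.
have cs : continuous (@sinh R).
  move=> y; apply: differentiable_continuous; apply/derivable1_diffP.
  by case: (is_derive_sinh y).
have [c] := MVT x0 (fun z _ => is_derive_sinh z) (continuous_subspaceT cs).
rewrite in_itv /= => /andP[c0 cx]; rewrite subr0 mulrC.
have -> : sinh 0 = 0 :> R by rewrite /sinh oppr0 subrr mul0r.
rewrite subr0 => ->.
by rewrite ler_pM2l // ltW // cosh_lt // ltW.
Qed.

End Hyperbolic.

(** * Supporting lines of nonnegative slope *)

Section SupportLines.
Variable R : realType.
Implicit Types (f : R -> R).

(* Equivalent to [f] being convex and nondecreasing on the whole real line; stated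
   with supporting lines because Jensen's inequality is then a weighted sum. *)
Definition nondecreasing_support f : Prop :=
  forall s, exists2 m, 0 <= m & forall t, f s + m * (t - s) <= f t.

Lemma nondecreasing_support_le f : nondecreasing_support f ->
  {homo f : s t / s <= t}.
Proof.
move=> fs s t st; have [m m0 /(_ t)] := fs s; apply: le_trans.
by rewrite lerDl mulr_ge0 // subr_ge0.
Qed.

Lemma nondecreasing_support_convex f (t a b : R) : nondecreasing_support f ->
  0 <= t <= 1 -> f (t * a + (1 - t) * b) <= t * f a + (1 - t) * f b.
Proof.
move=> fs /andP[t0 t1]; have [m _ fm] := fs (t * a + (1 - t) * b).
by have := fm a; have := fm b; nra.
Qed.

End SupportLines.

(** * Supporting lines of gbar *)

Section Profile.
Variables (R : realType) (psi : R -> R).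
Hypothesis psiC2 : C2_within (@nonneg_reals R) psi.
Hypothesis dpsi0 : dpsi psi 0 = 0.
Hypothesis dpsi_ge0 : forall x : R, 0 < x -> 0 <= dpsi psi x.
Hypothesis psi_conv : forall x : R, 0 < x ->
  0 <= d2psi psi x * sinh x - dpsi psi x * cosh x.

Let q (x : R) := dpsi psi x / sinh x.

Let nonnegP (x : R) : 0 <= x -> x \in @nonneg_reals R.
Proof. by move=> x0; rewrite inE /nonneg_reals /= in_itv /= andbT. Qed.

Let is_derive_psi (x : R) : 0 < x -> is_derive x 1 psi (dpsi psi x).
Proof.
move=> x0; case: psiC2 => d _ _; apply: derivable1_within_is_derive => //.
exact/d/nonnegP/ltW.
Qed.

Let is_derive_dpsi (x : R) : 0 < x -> is_derive x 1 (dpsi psi) (d2psi psi x).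
Proof.
move=> x0; case: psiC2 => _ d _; apply: derivable1_within_is_derive => //.
exact/d/nonnegP/ltW.
Qed.

(** The expression in [psi_conv] is the numerator of q' in the quotient rule. *)
Lemma dpsi_div_sinh_le (x y : R) : 0 < x -> x < y -> q x <= q y.
Proof.
move=> x0 xy.
have dq (z : R) : 0 < z -> is_derive z 1 q
    ((d2psi psi z * sinh z - dpsi psi z * cosh z) / sinh z ^+ 2).
  move=> z0; have sz : sinh z != 0 by rewrite gt_eqF // sinh_gt0.
  have -> : (d2psi psi z * sinh z - dpsi psi z * cosh z) / sinh z ^+ 2 =
      dpsi psi z *: (- sinh z ^- 2 *: cosh z) + (sinh z)^-1 *: d2psi psi z.
    by rewrite /GRing.scale /=; field.
  exact: is_deriveM (is_derive_dpsi z0) (is_deriveV sz (is_derive_sinh z)).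
have xin (z : R) : z \in `]x, y[%R -> 0 < z.
  by rewrite in_itv /= => /andP[xz _]; exact: lt_trans xz.
have cq : {within `[x, y], continuous q}.
  apply: derivable_within_continuous => z; rewrite in_itv /= => /andP[xz _].
  by case: (dq z (lt_le_trans x0 xz)).
have [c cxy E] := MVT xy (fun (z : R) zxy => dq z (xin z zxy)) cq.
rewrite -subr_ge0 E mulr_ge0 ?subr_ge0 ?(ltW xy) // divr_ge0 ?psi_conv ?xin //.
by rewrite sqr_ge0.
Qed.

(** The point c is interior, hence positive even when a = 0, where [q] divides by zero. *)
Lemma psi_cosh_MVT (a b : R) : 0 <= a -> a < b -> exists2 c,
  a < c < b & psi b - psi a = q c * (cosh b - cosh a).
Proof.
move=> a0 ab; have pos (z : R) : z \in `]a, b[%R -> 0 < z.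
  by rewrite in_itv /= => /andP[az _]; exact: le_lt_trans az.
have cpsi : {within `[a, b], continuous psi}.
  by case: psiC2 => d _ _; exact: derivable1_within_continuous.
have [c cab E] := cauchy_MVT ab cpsi (continuous_subspaceT (@continuous_cosh R))
  (fun (z : R) zab => is_derive_psi (pos _ zab)) (fun z _ => is_derive_cosh z)
  (fun (z : R) zab => lt0r_neq0 (sinh_gt0 (pos _ zab))).
exists c; first by move: cab; rewrite in_itv.
by rewrite /q E divfK // gt_eqF // subr_gt0 cosh_lt.
Qed.

(** Since psi' 0 = 0, this is the difference quotient of psi' at 0. *)
Let dpsi_cvg0 : dpsi psi y / y @[y --> 0^'+] --> d2psi psi 0.
Proof.
have [_ d _] := psiC2.
have := derivable1_within_cvg0 (d 0 (nonnegP (lexx 0))).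
rewrite -/(d2psi psi) -/(dpsi psi) dpsi0.
by under [X in X @ _]eq_fun do rewrite subr0.
Qed.

Lemma d2psi0_ge0 : 0 <= d2psi psi 0.
Proof.
apply: (cvgr_to_ge dpsi_cvg0); near=> y.
by rewrite divr_ge0 ?dpsi_ge0.
Unshelve. all: by end_near. Qed.

(** For 0 < y < x, sinh y <= y cosh y and the monotonicity of q give psi' y / y <= q x * cosh y;
    then y tends to 0. *)
Lemma d2psi0_le (x : R) : 0 < x -> d2psi psi 0 <= q x.
Proof.
move=> x0.
have q0 (y : R) : 0 < y -> 0 <= q y.
  by move=> y0; rewrite divr_ge0 ?dpsi_ge0 // ltW // sinh_gt0.
have qc : q x * cosh y @[y --> 0^'+] --> q x.
  rewrite -[X in _ --> X]mulr1 -(cosh0 R); apply: cvgM; first exact: cvg_cst.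
  by apply: cvg_at_right_filter; exact: continuous_cosh.
apply: (ler_cvg_to dpsi_cvg0 qc); near=> y.
have y0 : 0 < y by [].
have yx : y < x by near: y; exact: nbhs_right_lt.
have sy := sinh_gt0 y0.
have qE : dpsi psi y = q y * sinh y by rewrite /q divfK // gt_eqF.
rewrite ler_pdivrMr // qE.
apply: (@le_trans _ _ (q y * (y * cosh y))).
  by rewrite ler_wpM2l ?q0 // sinh_le.
rewrite -[leRHS]mulrA (mulrC y); apply: ler_wpM2r; last exact: dpsi_div_sinh_le.
by rewrite mulr_ge0 ?(ltW y0) // (le_trans ler01) // cosh_ge1 // ltW.
Unshelve. all: by end_near. Qed.

(** In the variable cosh, the chord from x to y has slope [q c] with c between x and y. As q is
    nondecreasing, [q c - q x] has the sign of y - x or vanishes. *)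
Lemma psi_support (x y : R) : 0 < x -> 0 <= y ->
  psi x + q x * (cosh y - cosh x) <= psi y.
Proof.
move=> x0 y0; case: (ltgtP x y) => [xy|yx|<-]; last by rewrite subrr mulr0 addr0.
- have [c /andP[xc cy] E] := psi_cosh_MVT (ltW x0) xy.
  have := dpsi_div_sinh_le x0 xc; have := cosh_lt (ltW x0) xy; nra.
- have [c /andP[yc cx] E] := psi_cosh_MVT y0 yx.
  have := dpsi_div_sinh_le (le_lt_trans y0 yc) cx; have := cosh_lt y0 yx; nra.
Qed.

Lemma psi_support0 (y : R) : 0 <= y ->
  psi 0 + d2psi psi 0 * (cosh y - 1) <= psi y.
Proof.
rewrite le_eqVlt => /predU1P[<-|y0]; first by rewrite cosh0 subrr mulr0 addr0.
have [c /andP[c0 _] E] := psi_cosh_MVT (lexx 0) y0.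
have := d2psi0_le c0; have := cosh_lt (lexx 0) y0.
by move: E; rewrite cosh0; nra.
Qed.

Lemma gbar_psi_cosh (x : R) : 0 <= x -> gbar_psi psi (2 * cosh x) = psi x.
Proof.
move=> x0; rewrite /gbar_psi (mulrC 2) mulfK // coshK //.
move: (x0); rewrite le_eqVlt => /predU1P[<-|xp].
  by rewrite cosh0 mul1r lexx subrr mulr0 addr0.
have := cosh_lt (lexx 0) xp; rewrite cosh0 => c1.
by rewrite ifN // -ltNge; lra.
Qed.

Lemma g_psi_cosh (x : R) : 0 <= x -> g_psi psi (2 * cosh x) = psi x.
Proof. by move=> x0; rewrite /g_psi (mulrC 2) mulfK // coshK. Qed.

Lemma ge2_cosh (s : R) : 2 <= s -> exists2 x, 0 <= x & s = 2 * cosh x.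
Proof.
move=> s2; have [x x0 E] : exists2 x, 0 <= x & cosh x = s / 2 by apply: cosh_surj; lra.
by exists x => //; rewrite E mulrC divfK.
Qed.

Lemma gbar_psi_support : nondecreasing_support (gbar_psi psi).
Proof.
move=> s; have d0 := d2psi0_ge0.
have [s2|/ltW s2] := leP s 2.
  exists (2^-1 * d2psi psi 0); first by rewrite mulr_ge0.
  move=> t; have -> : gbar_psi psi s = psi 0 + 2^-1 * d2psi psi 0 * (s - 2).
    by rewrite /gbar_psi s2.
  have [t2|/ltW t2] := leP t 2; first by rewrite /gbar_psi t2; lra.
  have [y y0 ->] := ge2_cosh t2; rewrite gbar_psi_cosh //.
  have := psi_support0 y0; nra.
have [x x0 ->] := ge2_cosh s2; rewrite gbar_psi_cosh //.
(* x = 0 means s = 2. As [q 0] is a division by zero, the slope is taken from the affine piece. *)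
move: x0; rewrite le_eqVlt => /predU1P[<-|x0].
  exists (2^-1 * d2psi psi 0); first by rewrite mulr_ge0.
  rewrite cosh0 mulr1 => t.
  have [t2|/ltW t2] := leP t 2; first by rewrite /gbar_psi t2; lra.
  have [y y0 ->] := ge2_cosh t2; rewrite gbar_psi_cosh //.
  have := psi_support0 y0; nra.
have qx := d2psi0_le x0.
(* The factor 1/2 converts slopes in cosh x to slopes in s = 2 cosh x. *)
exists (2^-1 * q x); first by rewrite mulr_ge0 // (le_trans d0).
move=> t; have [t2|/ltW t2] := leP t 2.
  rewrite /gbar_psi t2; have := psi_support x0 (lexx 0); rewrite cosh0.
  (* The supporting line is below gbar at t = 2 and at least as steep as the affine piece, so it
     stays below to the left of 2. *)
  have : (d2psi psi 0 - q x) * (t - 2) >= 0 by nra.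
  lra.
have [y y0 ->] := ge2_cosh t2; rewrite gbar_psi_cosh //.
have := psi_support x0 y0; nra.
Qed.

End Profile.

(** * Gram matrices, partial isometries and Bessel's inequality *)

Section SingularValueConvexity.
Import complex.
Local Open Scope sesquilinear_scope.
Variables (R : realType) (n : nat).
Implicit Types (X Y : 'M[R]_n) (U V M P : 'M[R[i]]_n) (s f g : 'I_n -> R).
Local Notation toC := (real_complex R).

Lemma trmxC_mul m p q (A : 'M[R[i]]_(m, p)) (B : 'M[R[i]]_(p, q)) :
  (A *m B) ^t* = B ^t* *m A ^t*.
Proof. by rewrite trmx_mul map_mxM. Qed.

Lemma trmxC_toC m p (A : 'M[R]_(m, p)) : (map_mx toC A) ^t* = map_mx toC A^T.
Proof. by apply/matrixP => i j; rewrite !mxE; exact: conjc_real. Qed.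

Lemma gram_diag M i : (M ^t* *m M) i i = \sum_k `|M k i| ^+ 2.
Proof. by rewrite mxE; apply: eq_bigr => k _; rewrite !mxE normCK mulrC. Qed.

Lemma gram_eq0 M : M ^t* *m M = 0 -> M = 0.
Proof.
move=> M0; apply/matrixP => i j; rewrite [RHS]mxE.
have := gram_diag M j; rewrite M0 mxE => /esym/eqP.
rewrite psumr_eq0 => [/allP/(_ i)|k _]; last by rewrite exprn_ge0.
by rewrite mem_index_enum => /(_ isT) /=; rewrite sqrf_eq0 normr_eq0 => /eqP.
Qed.

(** Weaker than unitarity, so that a factor of a singular value decomposition may have zero columns.
    Both products of U with its adjoint are then orthogonal projections. *)
Definition partial_isometry U : Prop := U *m U ^t* *m U = U.

Lemma unitary_partial_isometry U : U \is unitarymx -> partial_isometry U.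
Proof. by move=> /unitarymxP UU; rewrite /partial_isometry UU mul1mx. Qed.

Lemma partial_isometry_trmxC U : partial_isometry U -> partial_isometry (U ^t*).
Proof.
move=> UU; have : (U *m U ^t* *m U) ^t* = U ^t* by rewrite UU.
by rewrite !trmxC_mul mulmxA.
Qed.

(** With Q the projection complementary to [U *m U ^t*], the difference of the two sides is a
    diagonal entry of the Gram matrix of [Q *m M], hence nonnegative. *)
Lemma partial_isometry_gram_le U M i : partial_isometry U ->
  (M ^t* *m (U *m U ^t*) *m M) i i <= (M ^t* *m M) i i.
Proof.
move=> UU; pose Q := 1%:M - U *m U ^t*.
have QQ : Q ^t* *m Q = Q.
  have -> : Q ^t* = Q.
    rewrite /Q linearB /= map_mxB trmx1 map_mx1.
    by rewrite -[(U *m _) ^T ^ _]/((U *m U ^t*) ^t*) trmxC_mul trmxCK.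
  by rewrite /Q mulmxBl mul1mx mulmxBr mulmx1 mulmxA UU subrr subr0.
have QM : (Q *m M) ^t* *m (Q *m M) = M ^t* *m M - M ^t* *m (U *m U ^t*) *m M.
  rewrite trmxC_mul -mulmxA (mulmxA _ Q) QQ /Q mulmxBl mulmxBr mul1mx.
  by rewrite !mulmxA.
have entryB (A B : 'M[R[i]]_n) : (A - B) i i = A i i - B i i by rewrite !mxE.
rewrite -subr_ge0 -entryB -QM gram_diag.
by apply: sumr_ge0 => k _; rewrite exprn_ge0.
Qed.

Lemma bessel U V i : partial_isometry U -> partial_isometry V ->
  \sum_k `|(U ^t* *m V) i k| ^+ 2 <= 1.
Proof.
move=> Up Vp.
have -> : \sum_k `|(U ^t* *m V) i k| ^+ 2 = (U ^t* *m (V *m V ^t*) *m U) i i.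
  rewrite (_ : U ^t* *m _ *m U = ((V ^t* *m U) ^t*) *m (V ^t* *m U)); last first.
    by rewrite trmxC_mul trmxCK !mulmxA.
  rewrite gram_diag; apply: eq_bigr => k _.
  have -> : V ^t* *m U = (U ^t* *m V) ^t* by rewrite trmxC_mul trmxCK.
  by rewrite [X in _ = `|X| ^+ 2]mxE [X in _ = `|_ X| ^+ 2]mxE norm_conjC.
apply: (le_trans (partial_isometry_gram_le U i Vp)).
have := partial_isometry_gram_le 1%:M i (partial_isometry_trmxC Up).
by rewrite trmxCK trmx1 map_mx1 !mul1mx !mulmx1 [leRHS]mxE eqxx.
Qed.

(** * Singular value decomposition of a real matrix *)

Let D f : 'M[R[i]]_n := diag_mx (\row_i toC (f i)).

Let DM f g : D f *m D g = D (fun i => f i * g i).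
Proof. by rewrite mulmx_diag; congr diag_mx; apply/rowP => i; rewrite !mxE rmorphM. Qed.

Let D_trmxC f : (D f) ^t* = D f.
Proof.
rewrite tr_diag_mx map_diag_mx; congr diag_mx; apply/rowP => i; rewrite !mxE.
exact: conjc_real.
Qed.

Let eq_D f g : f =1 g -> D f = D g.
Proof. by move=> fg; congr diag_mx; apply/rowP => i; rewrite !mxE fg. Qed.

Lemma is_singular_values_gram X P s : (forall i, 0 <= s i) -> P \is unitarymx ->
  map_mx toC (X^T *m X) = P ^t* *m diag_mx (\row_i toC (s i ^+ 2)) *m P ->
  is_singular_values X (\row_i s i).
Proof.
move=> s0 Pu E; split=> [i|]; first by rewrite mxE.
apply: (map_poly_inj toC); rewrite map_char_poly E -invmx_unitary //.
rewrite char_poly_conj ?unitarymx_unit // char_poly_trig; last first.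
  by apply/is_trig_mxP => i j ij; rewrite !mxE -val_eqE ltn_eqF.
rewrite rmorph_prod; apply: eq_bigr => i _ /=.
by rewrite rmorphB /= map_polyX map_polyC /= !mxE eqxx mulr1n.
Qed.

(** The eigenvalues of the Gram matrix are squared column norms of [X *m P ^t*]. Nonnegativity in
    [R[i]] includes being real, so their square roots lie in R. *)
Lemma gram_spectral X : exists P, exists2 s, (forall i, 0 <= s i) &
  P \is unitarymx /\ map_mx toC (X^T *m X) = P ^t* *m D (fun i => s i ^+ 2) *m P.
Proof.
pose A := map_mx toC (X^T *m X).
have AE : A = (map_mx toC X) ^t* *m map_mx toC X by rewrite trmxC_toC /A map_mxM.
have An : A \is normalmx.
  by apply/normalmxP; rewrite AE trmxC_mul trmxCK.
have := orthomx_spectralP An; set P := spectralmx A; set d := spectral_diag A => PdP.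
have Pu : P \is unitarymx := spectral_unitarymx A.
rewrite invmx_unitary // in PdP; have PPt := unitarymxP Pu.
have dE i : d 0 i = \sum_k `|(map_mx toC X *m P ^t*) k i| ^+ 2.
  rewrite -gram_diag trmxC_mul trmxCK mulmxA -(mulmxA P) -AE PdP.
  by rewrite !mulmxA PPt mul1mx -mulmxA PPt mulmx1 mxE eqxx mulr1n.
have d_ge0 i : 0 <= d 0 i by rewrite dE sumr_ge0 // => k _; rewrite exprn_ge0.
exists P, (fun i => Num.sqrt (Re (d 0 i))) => [i|]; first exact: sqrtr_ge0.
split; first exact: Pu.
suff <- : diag_mx d = D (fun i => Num.sqrt (Re (d 0 i)) ^+ 2) by exact: PdP.
congr diag_mx; apply/rowP => i.
rewrite mxE sqr_sqrtr; first by rewrite (RRe_real (ger0_real (d_ge0 i))).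
by have := d_ge0 i; rewrite lecE => /andP[].
Qed.

(** V diagonalizes the Gram matrix and U normalizes the columns of X V. The factorization serves to
    bound compressions of X; the last identity exhibits the singular values as diagonal entries
    linear in X for fixed U and V. *)
Lemma singular_value_decomposition X : exists U V, exists2 s, (forall i, 0 <= s i) &
  [/\ partial_isometry U, partial_isometry V, is_singular_values X (\row_i s i),
      map_mx toC X = U *m D s *m V ^t* & U ^t* *m map_mx toC X *m V = D s].
Proof.
have [P [s s0 [Pu E]]] := gram_spectral X.
have PPt := unitarymxP Pu.
have [Y YE] : exists Y : 'M[R[i]]_n, Y = map_mx toC X by exists (map_mx toC X).
have [V VE] : exists V, V = P ^t* by exists (P ^t*).
rewrite -YE.
have YV : V ^t* *m Y ^t* *m (Y *m V) = D (fun i => s i ^+ 2).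
  rewrite VE YE trmxCK mulmxA -(mulmxA P) trmxC_toC -map_mxM E.
  by rewrite !mulmxA PPt mul1mx -mulmxA PPt mulmx1.
(* If [s i = 0] then the i-th column of [U] vanishes, because [0^-1 = 0]: this is
   why [U] is only a partial isometry. *)
have [U UE] : exists U, U = Y *m V *m D (fun i => (s i)^-1).
  by exists (Y *m V *m D (fun i => (s i)^-1)).
have UtY : U ^t* *m Y *m V = D s.
  rewrite UE trmxC_mul trmxC_mul D_trmxC -!mulmxA (mulmxA (V ^t*)) YV DM.
  apply: eq_D => i; have [->|si] := eqVneq (s i) 0; first by rewrite invr0 mul0r.
  by rewrite expr2 mulKf.
exists U, V, s => //; split.
- have UUU : U *m U ^t* *m U = U *m (U ^t* *m Y *m V) *m D (fun i => (s i)^-1).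
    by rewrite {3}UE !mulmxA.
  rewrite /partial_isometry UUU UtY UE -!mulmxA !DM.
  congr (_ *m (_ *m _)); apply: eq_D => i.
  have [->|si] := eqVneq (s i) 0; first by rewrite invr0 mul0r.
  by rewrite mulrA mulVf // mul1r.
- by rewrite VE; apply: partial_isometry_trmxC; exact: unitary_partial_isometry.
- exact: is_singular_values_gram Pu E.
- have PtP : V *m V ^t* = 1%:M by rewrite VE trmxCK; exact: mulmx1C.
  suff : Y *m V = U *m D s by move=> <-; rewrite -mulmxA PtP mulmx1.
  (* The two sides can differ only in columns with s i = 0, where Y V vanishes because its Gram
     matrix is diagonal with entries s i ^ 2. *)
  apply/eqP; rewrite -subr_eq0; apply/eqP/gram_eq0.
  have -> : Y *m V - U *m D s = Y *m V *m D (fun i => 1 - (s i)^-1 * s i).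
    rewrite UE -(mulmxA _ (D _)) DM -[X in X - _]mulmx1 -mulmxBr; congr (_ *m _).
    apply/matrixP => i j; rewrite !mxE -mulrnBl; congr (_ *+ _).
    by rewrite rmorphB.
  rewrite trmxC_mul D_trmxC trmxC_mul -!mulmxA (mulmxA Y V) (mulmxA (V ^t*)).
  rewrite (mulmxA _ (Y *m V)) YV !DM.
  apply/matrixP => i j; rewrite !mxE.
  have [->|si] := eqVneq (s i) 0; first by rewrite expr0n mul0r mulr0 mul0rn.
  by rewrite mulVf // subrr mul0r mul0rn.
- exact: UtY.
Qed.

(** Makes the unspecified order of [singular_values] harmless: the characteristic polynomial
    determines the squares up to permutation, and nonnegativity recovers the entries as square
    roots. *)
Lemma is_singular_values_sum X (s t : 'rV[R]_n) (phi : R -> R) :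
  is_singular_values X s -> is_singular_values X t ->
  \sum_i phi (s 0 i) = \sum_i phi (t 0 i).
Proof.
move=> [s0 sE] [t0 tE].
have prodE (u : 'rV[R]_n) : \prod_(i < n) ('X - (u 0 i ^+ 2)%:P) =
    \prod_(x <- [seq u 0 i ^+ 2 | i : 'I_n]) ('X - x%:P).
  by rewrite big_map big_enum.
have sumE (u : 'rV[R]_n) : (forall i, 0 <= u 0 i) -> \sum_i phi (u 0 i) =
    \sum_(x <- [seq u 0 i ^+ 2 | i : 'I_n]) phi (Num.sqrt x).
  move=> u0; rewrite big_map big_enum; apply: eq_bigr => i _.
  by rewrite sqrtr_sqr ger0_norm.
rewrite !sumE //; apply: perm_big; apply: prod_XsubC_eq.
by rewrite -!prodE -sE -tE.
Qed.

Lemma sum_singular_value X s (phi : R -> R) : is_singular_values X (\row_i s i) ->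
  \sum_i phi (singular_value X i) = \sum_i phi (s i).
Proof.
move=> Xs; rewrite (is_singular_values_sum phi (singular_valuesP X) Xs).
by under eq_bigr do rewrite mxE.
Qed.

(** * Convexity of sums over singular values *)

Lemma substochastic_sum_le (m : 'I_n -> 'I_n -> R) (a s : 'I_n -> R) (phi : R -> R) :
  (forall i k, 0 <= m i k) -> (forall i, \sum_k m i k <= 1) ->
  (forall k, \sum_i m i k <= 1) -> (forall k, 0 <= s k) ->
  (forall i, a i <= \sum_k m i k * s k) ->
  nondecreasing_support phi -> \sum_i phi (a i) <= \sum_k phi (s k).
Proof.
move=> m0 rows cols s0 as_ phis.
(* Jensen's inequality with the missing mass of row i placed at 0; the supporting line at the
   barycentre p is tested at each s k and at 0. *)
have jensen i : phi (a i) <= phi 0 + \sum_k m i k * (phi (s k) - phi 0).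
  apply: le_trans (nondecreasing_support_le phis (as_ i)) _.
  set p := \sum_k _; have [c _ cP] := phis p.
  have H : 0 <= \sum_k m i k * (phi (s k) - phi p - c * (s k - p)).
    by apply: sumr_ge0 => k _; rewrite mulr_ge0 //; have := cP (s k); lra.
  have -> : \sum_k m i k * (phi (s k) - phi 0) =
      \sum_k m i k * (phi (s k) - phi p - c * (s k - p)) +
      \sum_k c * (m i k * s k) + \sum_k m i k * (phi p - phi 0 - c * p).
    by rewrite -!big_split; apply: eq_bigr => k _ /=; ring.
  rewrite -mulr_sumr -/p -mulr_suml; have := rows i; have := cP 0; nra.
apply: le_trans (ler_sum _ (fun i _ => jensen i)) _.
rewrite big_split /= exchange_big /= -big_split /=; apply: ler_sum => k _.
rewrite -mulr_suml; have := cols k; have := nondecreasing_support_le phis (s0 k); nra.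
Qed.

Let abs2 (z : R[i]) : R := Re z ^+ 2 + Im z ^+ 2.

Let bessel_abs2 U V i : partial_isometry U -> partial_isometry V ->
  \sum_k abs2 ((U ^t* *m V) i k) <= 1.
Proof.
move=> Up Vp; rewrite -lecR rmorph_sum /=; apply: le_trans (bessel i Up Vp).
by under eq_bigr do rewrite add_Re2_Im2.
Qed.

Lemma sum_compression_le X U V (phi : R -> R) :
  nondecreasing_support phi -> partial_isometry U -> partial_isometry V ->
  \sum_i phi (Re ((U ^t* *m map_mx toC X *m V) i i)) <=
  \sum_i phi (singular_value X i).
Proof.
move=> phis Up Vp.
have [U1 [V1 [s s0 [U1p V1p Xs XE _]]]] := singular_value_decomposition X.
rewrite (sum_singular_value phi Xs).
pose A := U ^t* *m U1; pose B := V ^t* *m V1.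
have abs2C W W' i k : abs2 ((W ^t* *m W') i k) = abs2 ((W' ^t* *m W) k i).
  have -> : W ^t* *m W' = (W' ^t* *m W) ^t* by rewrite trmxC_mul trmxCK.
  rewrite [in LHS]mxE [in LHS]mxE /abs2; case: (X in X ^*) => x y /=.
  by rewrite sqrrN.
apply: (@substochastic_sum_le (fun i k => (abs2 (A i k) + abs2 (B i k)) / 2)) => //.
- by move=> i k; rewrite divr_ge0 // !addr_ge0 // sqr_ge0.
- move=> i; rewrite -mulr_suml big_split /=.
  by have := bessel_abs2 i Up U1p; have := bessel_abs2 i Vp V1p; rewrite -/A -/B; lra.
- move=> k; rewrite -mulr_suml big_split /=.
  (* Column sums are row sums of the adjoint, so Bessel applies with the two frames exchanged. *)
  under eq_bigr do rewrite abs2C.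
  under [X in _ + X]eq_bigr do rewrite abs2C.
  by have := bessel_abs2 k U1p Up; have := bessel_abs2 k V1p Vp; lra.
- move=> i; have -> : (U ^t* *m map_mx toC X *m V) i i =
      \sum_k toC (s k) * (A i k * conjc (B i k)).
    have -> : U ^t* *m map_mx toC X *m V = A *m D s *m B ^t*.
      by rewrite XE /A /B trmxC_mul trmxCK !mulmxA.
    rewrite mul_mx_diag mxE; apply: eq_bigr => k _.
    by rewrite !mxE mulrAC mulrC mulrA.
  rewrite raddf_sum; apply: ler_sum => k _ /=.
  (* |a| |b| <= (|a|^2 + |b|^2) / 2 *)
  case: (A i k) (B i k) (s0 k) => a1 a2 [b1 b2] /=; rewrite /abs2 /=.
  set t := s k => t0; have := sqr_ge0 (a1 - b1); have := sqr_ge0 (a2 - b2).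
  nra.
Qed.

Lemma sum_singular_value_convex X Y (phi : R -> R) (t : R) :
  nondecreasing_support phi -> 0 <= t <= 1 ->
  \sum_i phi (singular_value (t *: X + (1 - t) *: Y) i) <=
  t * \sum_i phi (singular_value X i) + (1 - t) * \sum_i phi (singular_value Y i).
Proof.
move=> phis t01; have /andP[t0 t1] := t01.
have [Z ZXY] : exists Z, Z = t *: X + (1 - t) *: Y by exists (t *: X + (1 - t) *: Y).
have [U [V [s s0 [Up Vp Zs _ ZE]]]] := singular_value_decomposition Z.
rewrite -ZXY (sum_singular_value phi Zs).
apply: (@le_trans _ _ (t * \sum_i phi (Re ((U ^t* *m map_mx toC X *m V) i i)) +
   (1 - t) * \sum_i phi (Re ((U ^t* *m map_mx toC Y *m V) i i)))); last first.
  by rewrite lerD // ler_wpM2l ?subr_ge0 // sum_compression_le.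
(* X and Y are compressed in the frames of Z, so that s is the same convex combination of the real
   parts of their diagonals. *)
have {}ZE : D s = toC t *: (U ^t* *m map_mx toC X *m V) +
    toC (1 - t) *: (U ^t* *m map_mx toC Y *m V).
  have ZC : map_mx toC Z = toC t *: map_mx toC X + toC (1 - t) *: map_mx toC Y.
    by apply/matrixP => i j; rewrite ZXY !mxE rmorphD !rmorphM.
  by rewrite -ZE ZC mulmxDr mulmxDl -!(scalemxAr _ (U ^t*)) !scalemxAl.
move: (U ^t* *m map_mx toC X *m V) (U ^t* *m map_mx toC Y *m V) ZE => A B DE.
rewrite !mulr_sumr -big_split /=; apply: ler_sum => i _.
suff -> : s i = t * Re (A i i) + (1 - t) * Re (B i i).
  exact: nondecreasing_support_convex.
have := congr1 (fun M => Re (M i i)) DE; rewrite /= !mxE eqxx mulr1n.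
by case: (A i i) (B i i) => x1 x2 [y1 y2] /= ->; rewrite !mul0r !subr0.
Qed.

(** With A the Gram matrix of X, that of X + X^-T is A + 2 + A^-1. The same P diagonalizes both, and
    s^2 + 2 + s^-2 = (s + 1/s)^2. *)
Lemma is_singular_values_addCof X : \det X = 1 -> exists2 s, (forall i, 0 < s i) &
  is_singular_values X (\row_i s i) /\
  is_singular_values (X + Cof X) (\row_i (s i + (s i)^-1)).
Proof.
move=> dX; have Xu : X \in unitmx by rewrite unitmxE dX unitr1.
have [P [s s0 [Pu E]]] := gram_spectral X.
have PPt := unitarymxP Pu; have PtP := mulmx1C PPt.
have s_gt0 i : 0 < s i.
  rewrite lt_def s0 andbT; apply/eqP => si.
  have : \det (map_mx toC (X^T *m X)) = 1.
    by rewrite det_map_mx det_mulmx det_tr dX mulr1 rmorph1.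
  rewrite E -invmx_unitary // !det_mulmx mulrAC -det_mulmx mulVmx ?unitarymx_unit //.
  rewrite det1 mul1r det_diag (bigD1 i) //= mxE si expr0n /= mul0r.
  by move=> /esym/eqP; rewrite oner_eq0.
exists s => //; split; first exact: is_singular_values_gram Pu E.
have t0 i : 0 <= s i + (s i)^-1 by rewrite addr_ge0 // invr_ge0.
apply: (is_singular_values_gram t0 Pu).
have CofX : Cof X = (invmx X)^T by rewrite /Cof dX scale1r.
pose Di := D (fun i => s i ^- 2).
have Ainv : map_mx toC (invmx X *m (invmx X)^T) = P ^t* *m Di *m P.
  have EI : map_mx toC (X^T *m X) *m (P ^t* *m Di *m P) = 1%:M.
    rewrite E -!mulmxA (mulmxA P) PPt mul1mx (mulmxA (D _)) DM.
    rewrite (_ : D _ = 1%:M) ?mul1mx //.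
    apply/matrixP => i j; rewrite !mxE mulfV ?rmorph1 //.
    by rewrite expf_neq0 // gt_eqF.
  have IX : invmx X *m (invmx X)^T *m (X^T *m X) = 1%:M.
    by rewrite -mulmxA (mulmxA (invmx X)^T) -trmx_mul mulmxV // trmx1 mul1mx mulVmx.
  by rewrite -[LHS]mulmx1 -EI mulmxA -map_mxM IX map_mx1 mul1mx.
have -> : (X + Cof X)^T *m (X + Cof X) =
    X^T *m X + (1%:M + 1%:M) + invmx X *m (invmx X)^T.
  rewrite CofX [(X + _)^T]linearD /= trmxK mulmxDl !mulmxDr mulVmx // -trmx_mul mulVmx // trmx1.
  by rewrite !addrA.
have DE : D (fun i => (s i + (s i)^-1) ^+ 2) = D (fun i => s i ^+ 2) + (1%:M + 1%:M) + Di.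
  apply/matrixP => i j; rewrite !mxE -!mulrnDl; congr (_ *+ _).
  rewrite -(rmorph1 toC) -!rmorphD; congr (toC _).
  by have := s_gt0 i; move=> /gt_eqF/negbT si; field.
rewrite -[diag_mx _]/(D (fun i => (s i + (s i)^-1) ^+ 2)) DE.
rewrite !map_mxD Ainv E map_mx1 !mulmxDr !mulmxDl !mulmx1.
by rewrite PtP.
Qed.

End SingularValueConvexity.

(** * Rank-one updates of determinant and inverse *)

Section RankOne.
Variables (F : fieldType) (n : nat).

(** Sylvester's identity: one block matrix is factored as lower times upper and as upper times lower
    triangular. *)
Lemma det_add1_mulC m (A : 'M[F]_(n, m)) (B : 'M[F]_(m, n)) :
  \det (1%:M + A *m B) = \det (1%:M + B *m A).
Proof.
have E1 : block_mx 1%:M (- B) A 1%:M =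
    block_mx 1%:M 0 A 1%:M *m block_mx 1%:M (- B) 0 (1%:M + A *m B).
  by rewrite mulmx_block !mul1mx !mul0mx !mulmx1 !addr0 mulmxN addrCA addNr addr0.
have E2 : block_mx 1%:M (- B) A 1%:M =
    block_mx (1%:M + B *m A) (- B) 0 1%:M *m block_mx 1%:M 0 A 1%:M.
  by rewrite mulmx_block !mul1mx !mul0mx !mulmx1 !mulmx0 !add0r mulNmx addrK.
have := E1; rewrite E2 => /(congr1 determinant).
by rewrite !det_mulmx !det_ublock !det_lblock !det1 !mulr1 !mul1r => ->.
Qed.

(** The Sherman-Morrison denominator 1 + t b^T X^-1 a equals 1 here, which makes the inverse affine
    in t. *)
Lemma invmx_rank_one_update (X : 'M[F]_n) (a b : 'cV[F]_n) (t : F) :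
  X \in unitmx -> b^T *m invmx X *m a = 0 ->
  invmx (X + t *: (a *m b^T)) = invmx X - t *: (invmx X *m a *m (b^T *m invmx X)).
Proof.
move=> Xu bXa; set K := _ - _.
have XK : (X + t *: (a *m b^T)) *m K = 1%:M.
  rewrite /K mulmxBr mulmxDl mulmxV // mulmxDl -scalemxAr -!scalemxAl -!scalemxAr.
  rewrite !mulmxA mulmxV // mul1mx -(mulmxA a) -(mulmxA a) bXa mulmx0 !mul0mx !scaler0.
  by rewrite addr0 addrK.
have Xt : X + t *: (a *m b^T) \in unitmx by have [] := mulmx1_unit XK.
by rewrite -[LHS]mulmx1 -XK mulKmx.
Qed.

End RankOne.

(** * Convexity of the energy *)

Section Convexity.
Variables (R : realType) (psi : R -> R).
Hypothesis gbar_support : nondecreasing_support (gbar_psi psi).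

Lemma convex_functionP (E : lmodType R) (A : set E) (f : E -> R) :
  (forall (t : R) (x y : E), 0 <= t <= 1 -> A x -> A y ->
    f (t *: x + (1 - t) *: y) <= t * f x + (1 - t) * f y) ->
  convex_function A f.
Proof.
move=> fP t x y /set_mem xA /set_mem yA.
by have /= := fP t%:num x y; apply => //; apply/andP; split.
Qed.

Lemma P_psi_convex : convex_function (M3xM3xpos (R := R)) (P_psi psi).
Proof.
apply: convex_functionP => t Z T t01 _ _; rewrite /P_psi.
have -> : (t *: Z + (1 - t) *: T).1.1 + (t *: Z + (1 - t) *: T).1.2 =
    t *: (Z.1.1 + Z.1.2) + (1 - t) *: (T.1.1 + T.1.2).
  by rewrite !scalerDr addrACA.
exact: sum_singular_value_convex.
Qed.

Lemma W_psi_P_psi (F : 'M[R]_3) : SL F ->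
  W_psi psi F = P_psi psi (F, Cof F, \det F).
Proof.
move=> detF; have [s s0 [Fs FCs]] := is_singular_values_addCof detF.
rewrite /W_psi /P_psi /= (sum_singular_value (gbar_psi psi) FCs).
rewrite (sum_singular_value (fun x => psi `|ln x|) Fs).
apply: eq_bigr => i _; rewrite -gbar_psi_cosh ?normr_ge0 // cosh_ln //.
by rewrite mulrC divfK.
Qed.

Lemma rank_one_convex_W_psi : rank_one_convex_SL (W_psi psi).
Proof.
move=> F a b FSL FtSL; have Fu : F \in unitmx by rewrite unitmxE FSL unitr1.
(* By Sylvester, det (F + a b^T) = 1 + b^T F^-1 a, and at t = 1 this determinant is 1. *)
have bFa : b^T *m invmx F *m a = 0.
  have /FtSL : 0 <= (1 : R) <= 1 by rewrite ler01 lexx.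
  rewrite /SL /= scale1r.
  have -> : F + a *m b^T = F *m (1%:M + invmx F *m a *m b^T).
    by rewrite mulmxDr mulmx1 !mulmxA mulmxV // mul1mx.
  rewrite det_mulmx FSL mul1r det_add1_mulC mulmxA det_mx11 mxE [1%:M 0 0]mxE eqxx.
  rewrite -[RHS]addr0 => /addrI E; apply/matrixP => i j.
  by rewrite !ord1 E mxE.
(* -G is the velocity of Cof along the line. *)
pose G := (invmx F *m a *m (b^T *m invmx F))^T.
have WE (t : R) : 0 <= t <= 1 -> W_psi psi (F + t *: (a *m b^T)) =
    \sum_(i < 3) gbar_psi psi (singular_value
      (F + (invmx F)^T + t *: (a *m b^T - G)) i).
  move=> t01; have Ft := FtSL t t01; rewrite W_psi_P_psi // /P_psi /=.
  apply: eq_bigr => i _; congr (gbar_psi psi (singular_value _ i)).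
  rewrite /Cof Ft scale1r invmx_rank_one_update // linearB linearZ /=.
  by rewrite scalerBr addrACA.
apply: convex_functionP => t x y t01 /=; rewrite !in_itv /= => x01 y01.
have xy01 : 0 <= t * x + (1 - t) * y <= 1 by nra.
rewrite WE // WE // WE //.
have -> : F + (invmx F)^T + (t * x + (1 - t) * y) *: (a *m b^T - G) =
   t *: (F + (invmx F)^T + x *: (a *m b^T - G)) +
   (1 - t) *: (F + (invmx F)^T + y *: (a *m b^T - G)).
  move: (F + _) (a *m b^T - G) => A B; apply/matrixP => i j; rewrite !mxE; ring.
exact: sum_singular_value_convex.
Qed.

End Convexity.

Unset Implicit Arguments.
Set Strict Implicit.

Theorem proposition2p4 (R : realType) (psi : R -> R)
    (psiC2 : C2_within (@nonneg_reals R) psi)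
    (dpsi0 : dpsi psi 0 = 0)
    (dpsi_ge0 : forall x : R, 0 < x -> 0 <= dpsi psi x) :
  ((forall x : R, 0 < x -> 0 <= d2psi psi x * sinh x - dpsi psi x * cosh x) <->
   (forall x : R, 0 < x -> dpsi psi x * coth x <= d2psi psi x)) /\
  ((forall x : R, 0 < x -> 0 <= d2psi psi x * sinh x - dpsi psi x * cosh x) ->
   [/\ convex_function (E := R^o) `[2, +oo[%classic (g_psi psi) /\
       {in `[2, +oo[%R &, {homo g_psi psi : s t / s <= t}},
       [/\ convex_function (E := R^o) `[0, +oo[%classic (gbar_psi psi),
           {in `[0, +oo[%R &, {homo gbar_psi psi : s t / s <= t}} &
           {in `[2, +oo[%R, gbar_psi psi =1 g_psi psi}],
       [/\ convex_function (M3xM3xpos (R := R)) (P_psi psi),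
           (forall F : 'M[R]_3, SL F ->
              W_psi psi F = P_psi psi (F, Cof F, \det F)) &
           (exists V : 'M[R]_3 -> R, polyconvex V /\
              (forall F : 'M[R]_3, SL F -> W_psi psi F = V F))] &
       rank_one_convex_SL (W_psi psi)]).
Proof.
split.
  by split=> H x x0; have := H x x0; have s0 := sinh_gt0 x0;
    rewrite /coth mulrA ler_pdivrMr // subr_ge0.
move=> psi_conv; have gs := gbar_psi_support psiC2 dpsi0 dpsi_ge0 psi_conv.
have gE : {in `[2, +oo[%R, gbar_psi psi =1 g_psi psi}.
  move=> s; rewrite in_itv /= andbT => /ge2_cosh[x x0 ->].
  by rewrite gbar_psi_cosh // g_psi_cosh.
have gmono := nondecreasing_support_le gs.
have PW := W_psi_P_psi psi.
split.
- split.
    (* g inherits convexity from gbar, since [2, oo) is stable under convex combinations. *)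
    apply: convex_functionP => t x y t01; rewrite /= !in_itv /= !andbT => x2 y2.
    rewrite -!gE ?in_itv ?andbT //=; first exact: nondecreasing_support_convex.
    by rewrite /GRing.scale /=; nra.
  by move=> s t s2 t2 st; rewrite -!gE //; exact: gmono.
- split => //.
    apply: convex_functionP => t x y t01 _ _; exact: nondecreasing_support_convex.
  by move=> s t _ _; exact: gmono.
- split => //; first exact: P_psi_convex.
  exists (fun F => P_psi psi (F, Cof F, \det F)); split => //.
  by exists (P_psi psi); split => //; exact: P_psi_convex.
- exact: rank_one_convex_W_psi.
Qed.
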